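(* Let $d\geq 1$, let $\mathcal S=\{\sigma\in L(\mathbb C^d):\sigma\geq 0,\ \mathrm{Tr}(\sigma)=1\}$, and let $\mathrm d\rho$ be any probability measure on $\mathcal S$. Then for every $\sigma\in\mathcal S$, $$\mathbb E_\rho[F(\rho,\sigma)]\leq\frac1d\left(1+\sqrt{d-1}\,\sqrt{d\left(\mathbb E_\rho\Big[\sqrt{1-\mathrm{Tr}(\rho^2)}\Big]^2+\mathrm{Tr}\big(\mathbb E_\rho[\rho]^2\big)\right)-1}\right).$$
   Context: The fidelity of $\rho,\sigma\in\mathcal S$ is $F(\rho,\sigma)=\big[\mathrm{Tr}\sqrt{\sqrt\rho\,\sigma\sqrt\rho}\big]^2$. $\mathbb E_\rho$ denotes expectation with respect to $\mathrm d\rho$. *)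

(* Defs.v *)
From HB Require Import structures.
From mathcomp Require Import all_boot all_order all_algebra.
From mathcomp Require Import all_classical all_reals all_analysis.
From mathcomp Require Import complex.
Set Implicit Arguments. Unset Strict Implicit. Unset Printing Implicit Defensive.
Import Order.TTheory GRing.Theory Num.Theory.
Local Open Scope ring_scope.

Section QDefs.
Variable R : realType.
Variable d : nat.
Local Notation C := (R[i]).

Definition adjmx m n (A : 'M[C]_(m, n)) : 'M[C]_(n, m) :=
  \matrix_(i, j) conjc (A j i).

(* positive semidefinite: Hermitian with nonnegative quadratic form
   (0 <= z in C means z is real and nonnegative) *)
Definition psd (A : 'M[C]_d) : Prop :=
  adjmx A = A /\ forall v : 'cV[C]_d, 0 <= (adjmx v *m A *m v) 0 0.

Definition density (A : 'M[C]_d) : Prop := psd A /\ \tr A = 1.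

Definition msqrt (A : 'M[C]_d) : 'M[C]_d :=
  xget 0 [set X : 'M[C]_d | psd X /\ X *m X = A].

Definition fidelity (rho sigma : 'M[C]_d) : C :=
  (\tr (msqrt (msqrt rho *m sigma *m msqrt rho))) ^+ 2.
End QDefs.

Definition Ereal (R : realType) (dT : measure_display) (T : measurableType dT)
  (P : probability T R) (f : T -> R) : R := Rintegral P setT f.

Definition Emx (R : realType) (dT : measure_display) (T : measurableType dT)
  (P : probability T R) (d : nat) (rho : T -> 'M[R[i]]_d) : 'M[R[i]]_d :=
  \matrix_(i, j) Complex (Ereal P (fun t => complex.Re (rho t i j)))
                         (Ereal P (fun t => complex.Im (rho t i j))).

(* Main.v *)
(* The pointwise estimate is the super-fidelity bound
     F(rho, sigma) <= tr (rho sigma) + sqrt (1 - tr rho^2) sqrt (1 - tr sigma^2).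
   Put S = sqrt sigma, R = sqrt rho, let A = |S R| and let W be the partial
   isometry with A = W S R. Then F - tr (rho sigma) = (tr A)^2 - tr A^2 is
   twice the trace of the second compound of (W S) R, and Cauchy-Schwarz for
   second compounds bounds its square by (1 - tr sigma^2) (1 - tr rho^2).
   Averaging over rho leaves tr (mu sigma) + a sqrt (1 - tr sigma^2), where
   mu = E rho and a = E sqrt (1 - tr rho^2). Splitting off the components of mu
   and sigma along the identity, a last Cauchy-Schwarz inequality eliminates
   sigma. *)
Require Import Defs.
From HB Require Import structures.
From mathcomp Require Import all_boot all_order all_algebra.
From mathcomp Require Import all_classical all_reals all_analysis.
From mathcomp Require Import complex measurable_realfun ring.
Import Order.TTheory GRing.Theory Num.Theory.
Local Open Scope ring_scope.
Local Open Scope sesquilinear_scope.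

(** * Second compounds: sums of products of two-by-two minors *)

Section Minors.
Set Implicit Arguments. Unset Strict Implicit.
Context {C : numClosedFieldType}.

(** A polarised Cauchy-Binet formula. Row pairs and column pairs are ordered and unrestricted, which
    produces the factor 2. *)
Lemma sum_minors m n (X Z : 'M[C]_(m, n)) (Y W : 'M[C]_(n, m)) :
  \sum_(p : ('I_m * 'I_m) * ('I_n * 'I_n))
    (X p.1.1 p.2.1 * Z p.1.2 p.2.2 - X p.1.2 p.2.1 * Z p.1.1 p.2.2) *
    (Y p.2.1 p.1.1 * W p.2.2 p.1.2 - Y p.2.1 p.1.2 * W p.2.2 p.1.1) =
  (\tr (X *m Y) * \tr (Z *m W) - \tr (X *m Y *m (Z *m W))) *+ 2.
Proof.
pose S (F : 'I_m -> 'I_m -> 'I_n -> 'I_n -> C) :=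
  \sum_(p : ('I_m * 'I_m) * ('I_n * 'I_n)) F p.1.1 p.1.2 p.2.1 p.2.2.
have SE F : S F = \sum_i \sum_k \sum_j \sum_l F i k j l.
  transitivity (\sum_(p1 : 'I_m * 'I_m) \sum_(p2 : 'I_n * 'I_n)
      F p1.1 p1.2 p2.1 p2.2); first by rewrite [RHS]pair_bigA.
  rewrite [RHS]pair_bigA; apply: eq_bigr => p _.
  by rewrite [RHS]pair_bigA.
have SC F : S F = S (fun i k => F k i) by rewrite !SE exchange_big.
have St : S (fun i k j l => X i j * Y j i * (Z k l * W l k)) =
    \tr (X *m Y) * \tr (Z *m W).
  rewrite SE /mxtrace mulr_suml; apply: eq_bigr => i _.
  rewrite mulr_sumr; apply: eq_bigr => k _.
  rewrite !mxE mulr_suml; apply: eq_bigr => j _.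
  by rewrite mulr_sumr.
have Sm : S (fun i k j l => X i j * Y j k * (Z k l * W l i)) =
    \tr (X *m Y *m (Z *m W)).
  rewrite SE /mxtrace; apply: eq_bigr => i _.
  rewrite mxE; apply: eq_bigr => k _.
  rewrite !mxE mulr_suml; apply: eq_bigr => j _.
  by rewrite mulr_sumr.
(* Multiplying out the two minors gives four sums. Exchanging [i] and [k] identifies them in pairs:
   two are the product of traces, two the trace of the product. *)
transitivity (S (fun i k j l => X i j * Y j i * (Z k l * W l k))
   + S (fun i k j l => X k j * Y j k * (Z i l * W l i))
   - S (fun i k j l => X i j * Y j k * (Z k l * W l i))
   - S (fun i k j l => X k j * Y j i * (Z i l * W l k))); last first.
  by rewrite [S (fun i k j l => X k j * Y j k * _)]SC
    [S (fun i k j l => X k j * Y j i * _)]SC St Sm; ring.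
by rewrite /S -big_split -!sumrB; apply: eq_bigr => p _ /=; ring.
Qed.

(** Lagrange's identity: twice the gap is the sum over [i] and [j] of the squared moduli of
    [x i * (y j)^* - x j * (y i)^*]. *)
Lemma cauchy_schwarz_sum (I : finType) (x y : I -> C) :
  `|\sum_i x i * y i| ^+ 2 <= (\sum_i `|x i| ^+ 2) * (\sum_i `|y i| ^+ 2).
Proof.
rewrite -subr_ge0 -(pmulrn_lge0 _ (ltn0Sn 1)).
suff -> : (( \sum_i `|x i| ^+ 2) * (\sum_i `|y i| ^+ 2)
    - `|\sum_i x i * y i| ^+ 2) *+ 2 =
    \sum_i \sum_j `|x i * (y j)^* - x j * (y i)^*| ^+ 2.
  by apply: sumr_ge0 => i _; apply: sumr_ge0 => j _; rewrite exprn_ge0.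
have -> : \sum_i \sum_j `|x i * (y j)^* - x j * (y i)^*| ^+ 2 =
    \sum_i \sum_j (`|x i| ^+ 2 * `|y j| ^+ 2 + `|x j| ^+ 2 * `|y i| ^+ 2
       - (x i * y i) * (x j * y j)^* - (x j * y j) * (x i * y i)^*).
  apply: eq_bigr => i _; apply: eq_bigr => j _.
  rewrite !normCK rmorphB !rmorphM /= !conjCK; ring.
rewrite !normCK rmorph_sum mulr2n.
under [RHS]eq_bigr => i _ do
  rewrite 2!sumrB big_split /= -!mulr_sumr -!mulr_suml.
by rewrite !(sumrB, big_split) /= -!mulr_suml -!mulr_sumr; ring.
Qed.

Lemma adjM m n p (A : 'M[C]_(m, n)) (B : 'M[C]_(n, p)) :
  (A *m B)^t* = B^t* *m A^t*.
Proof. by rewrite trmx_mul map_mxM. Qed.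

(* Twice the second elementary symmetric polynomial of the eigenvalues. *)
Definition e2 n (X : 'M[C]_n) := (\tr X) ^+ 2 - \tr (X *m X).

Lemma e2_mulC m n (X : 'M[C]_(m, n)) (Y : 'M[C]_(n, m)) :
  e2 (X *m Y) = e2 (Y *m X).
Proof. by rewrite /e2 (mxtrace_mulC X Y) -mulmxA (mxtrace_mulC X) !mulmxA. Qed.

Lemma sum_norm_minors m n (X Z : 'M[C]_(m, n)) :
  \sum_(p : ('I_m * 'I_m) * ('I_n * 'I_n))
    `|X p.1.1 p.2.1 * Z p.1.2 p.2.2 - X p.1.2 p.2.1 * Z p.1.1 p.2.2| ^+ 2 =
  (\tr (X *m X^t*) * \tr (Z *m Z^t*) - \tr (X *m X^t* *m (Z *m Z^t*))) *+ 2.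
Proof.
rewrite -sum_minors; apply: eq_bigr => p _.
by rewrite normCK rmorphB !rmorphM !mxE.
Qed.

(** Twice the gap is a sum of squared moduli of mixed minors of [X] and [Z]. *)
Lemma mxtrace_mul_gram_le m n (X Z : 'M[C]_(m, n)) :
  \tr (X *m X^t* *m (Z *m Z^t*)) <= \tr (X *m X^t*) * \tr (Z *m Z^t*).
Proof.
rewrite -subr_ge0 -(pmulrn_lge0 _ (ltn0Sn 1)) -sum_norm_minors.
by apply: sumr_ge0 => p _; rewrite exprn_ge0.
Qed.

Lemma e2_gram_ge0 m n (X : 'M[C]_(m, n)) : 0 <= e2 (X *m X^t*).
Proof. by rewrite subr_ge0 mxtrace_mul_gram_le. Qed.

(** With [P] and [Q] the two Gram matrices, the increment is [e2 Q] plus twice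
    [\tr P * \tr Q - \tr (P *m Q)], and both are nonnegative. This monotonicity later removes the
    partial isometry. *)
Lemma e2_gram_le_add m n (X Z : 'M[C]_(m, n)) :
  e2 (X *m X^t*) <= e2 (X *m X^t* + Z *m Z^t*).
Proof.
rewrite -subr_ge0; set P := X *m X^t*; set Q := Z *m Z^t*.
have -> : e2 (P + Q) - e2 P = e2 Q + (\tr P * \tr Q - \tr (P *m Q)) *+ 2.
  rewrite /e2 mulmxDl !mulmxDr !mxtraceD (mxtrace_mulC Q P); ring.
by rewrite addr_ge0 ?e2_gram_ge0 ?mulrn_wge0 // subr_ge0 mxtrace_mul_gram_le.
Qed.

(* The Cauchy-Schwarz inequality for the inner product of second compounds. *)
Lemma norm_e2_mul_le m n (X : 'M[C]_(m, n)) (Y : 'M[C]_(n, m)) :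
  `|e2 (X *m Y)| ^+ 2 <= e2 (X *m X^t*) * e2 (Y^t* *m Y).
Proof.
have e2E (A : 'M[C]_(m, n)) (B : 'M[C]_(n, m)) : e2 (A *m B) *+ 2 =
    \sum_(p : ('I_m * 'I_m) * ('I_n * 'I_n))
    (A p.1.1 p.2.1 * A p.1.2 p.2.2 - A p.1.2 p.2.1 * A p.1.1 p.2.2) *
    (B p.2.1 p.1.1 * B p.2.2 p.1.2 - B p.2.1 p.1.2 * B p.2.2 p.1.1).
  by rewrite sum_minors.
have e2n k l (A : 'M[C]_(k, l)) : e2 (A *m A^t*) *+ 2 =
    \sum_(p : ('I_k * 'I_k) * ('I_l * 'I_l))
    `|A p.1.1 p.2.1 * A p.1.2 p.2.2 - A p.1.2 p.2.1 * A p.1.1 p.2.2| ^+ 2.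
  by rewrite sum_norm_minors.
have := cauchy_schwarz_sum
 (fun p : ('I_m * 'I_m) * ('I_n * 'I_n) =>
    X p.1.1 p.2.1 * X p.1.2 p.2.2 - X p.1.2 p.2.1 * X p.1.1 p.2.2)
 (fun p => Y p.2.1 p.1.1 * Y p.2.2 p.1.2 - Y p.2.1 p.1.2 * Y p.2.2 p.1.1).
rewrite -e2E -e2n.
have -> : \sum_(p : ('I_m * 'I_m) * ('I_n * 'I_n))
    `|Y p.2.1 p.1.1 * Y p.2.2 p.1.2 - Y p.2.1 p.1.2 * Y p.2.2 p.1.1| ^+ 2 =
    e2 (Y^t* *m Y) *+ 2.
  rewrite -[X in _ *m X]trmxCK e2n; apply: eq_bigr => p _; rewrite !mxE.
  by rewrite -norm_conjC rmorphB !rmorphM.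
rewrite normrMn; move: `|e2 (X *m Y)| (e2 (X *m X^t*)) (e2 (Y^t* *m Y)) => x a b.

by rewrite exprMn_n mulrnAl mulrnAr -mulrnA lerMn2r.
Qed.

(** * The Hilbert-Schmidt inner product on Hermitian matrices *)

Lemma mxtrace_mulE n (A B : 'M[C]_n) :
  \tr (A *m B) = \sum_(p : 'I_n * 'I_n) A p.1 p.2 * B p.2 p.1.
Proof.
rewrite -(pair_bigA _ (fun i j => A i j * B j i)) /=.
by apply: eq_bigr => i _; rewrite mxE.
Qed.

Lemma mxtrace_sqr_hermitian n (A : 'M[C]_n) : A^t* = A ->
  \tr (A *m A) = \sum_(p : 'I_n * 'I_n) `|A p.1 p.2| ^+ 2.
Proof.
move=> hA; rewrite mxtrace_mulE; apply: eq_bigr => p _.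
by rewrite -{2}hA !mxE normCK.
Qed.

Lemma norm_mxtrace_mul_le n (A B : 'M[C]_n) : A^t* = A -> B^t* = B ->
  `|\tr (A *m B)| ^+ 2 <= \tr (A *m A) * \tr (B *m B).
Proof.
move=> hA hB; rewrite mxtrace_mulE !mxtrace_sqr_hermitian //.
apply: le_trans (cauchy_schwarz_sum (fun p => A p.1 p.2) (fun p => B p.2 p.1)) _.
rewrite le_eqVlt; apply/orP; left; apply/eqP; congr (_ * _).
by apply: eq_bigr => p _; rewrite -{1}hB !mxE norm_conjC.
Qed.

(** * Spectral calculus for Hermitian matrices *)

Definition unitary_diag n (U : 'M[C]_n) (l : 'rV[C]_n) :=
  U^t* *m diag_mx l *m U.

Lemma adj_unitary_diag n (U : 'M[C]_n) (l : 'rV[C]_n) :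
  (unitary_diag U l)^t* = unitary_diag U (map_mx Num.conj l).
Proof. by rewrite /unitary_diag !adjM trmxCK tr_diag_mx map_diag_mx mulmxA. Qed.

Lemma mul_unitary_diag n (U : 'M[C]_n) (l k : 'rV[C]_n) : U *m U^t* = 1%:M ->
  unitary_diag U l *m unitary_diag U k =
  unitary_diag U (\row_i (l 0 i * k 0 i)).
Proof.
move=> UU; rewrite /unitary_diag !mulmxA -(mulmxA _ U) UU mulmx1.
by rewrite -(mulmxA _ (diag_mx l)) mulmx_diag.
Qed.

Lemma unitary_diag_gram n (U : 'M[C]_n) (l : 'rV[C]_n) :
  (forall i, 0 <= l 0 i) ->
  unitary_diag U l = (diag_mx (\row_i sqrtC (l 0 i)) *m U)^t* *m
                     (diag_mx (\row_i sqrtC (l 0 i)) *m U).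
Proof.
move=> l0; rewrite adjM tr_diag_mx map_diag_mx mulmxA.
rewrite -(mulmxA _ (diag_mx _) (diag_mx _)) mulmx_diag.
congr (_ *m diag_mx _ *m _); apply/rowP => i; rewrite !mxE.
by rewrite /= geC0_conj ?sqrtC_ge0 // -expr2 sqrtCK.
Qed.

(** A Hermitian matrix is normal, so the spectral theorem applies. The eigenvalues are real because
    [U *m A *m U^t*] is again Hermitian and equals [diag_mx l]. *)
Lemma hermitian_unitary_diag n (A : 'M[C]_n) : A^t* = A ->
  exists U l, [/\ U *m U^t* = 1%:M, A = unitary_diag U l &
                  forall i, l 0 i \is Num.real].
Proof.
move=> hA.
have /orthomx_spectralP : A \is normalmx by apply/normalmxP; rewrite hA.
have Uu := spectral_unitarymx A.
rewrite invmx_unitary //; move: (spectralmx A) (spectral_diag A) Uu => U l.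
move=> /unitarymxP UU AE; exists U, l; split=> // i.
have AD : U *m A *m U^t* = diag_mx l.
  by rewrite AE !mulmxA UU mul1mx -mulmxA UU mulmx1.
have : (diag_mx l)^t* = diag_mx l by rewrite -AD !adjM trmxCK hA mulmxA.
by move/matrixP/(_ i i)/eqP; rewrite !mxE eqxx mulr1n -CrealE.
Qed.

(* [G] is the Moore-Penrose inverse of [A]. *)
Lemma hermitian_pinv n (A : 'M[C]_n) : A^t* = A ->
  exists G : 'M[C]_n,
    [/\ G^t* = G, A *m G = G *m A, A *m G *m A = A & G *m A *m G = G].
Proof.
move=> /hermitian_unitary_diag[U [l [UU -> lr]]].
(* The convention that the inverse of 0 is 0 makes [G] vanish on the kernel of [A], as a
   pseudoinverse must. *)
exists (unitary_diag U (\row_i (l 0 i)^-1)).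
rewrite adj_unitary_diag !mul_unitary_diag //.
split; congr (unitary_diag U _); apply/rowP => i; rewrite !mxE.
- by apply/eqP; rewrite -CrealE realV.
- by rewrite mulrC.
- by have [->|l0] := eqVneq (l 0 i) 0; rewrite ?mulr0 // mulfV // mul1r.
- have [->|l0] := eqVneq (l 0 i) 0; first by rewrite invr0 !mulr0.
  by rewrite mulVf // mul1r.
Qed.

(** * The super-fidelity bound as an inequality between second symmetric polynomials *)

Lemma superfidelity_e2 n (R S A : 'M[C]_n) :
  R^t* = R -> S^t* = S -> A^t* = A -> A *m A = R *m (S *m S) *m R ->
  `|e2 A| ^+ 2 <= e2 (S *m S) * e2 (R *m R).
Proof.
move=> hR hS hA AA; have [G [hG AG AGA GAG]] := hermitian_pinv hA.
(* [A = W S R] is a polar decomposition of [S R]: [W] is a partial isometry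
   and [Pi] the orthogonal projection onto its initial space *)
pose W := G *m R *m S; pose Pi := W^t* *m W.
have hW : W^t* = S *m R *m G by rewrite /W !adjM hR hS hG mulmxA.
have hPi : Pi^t* = Pi by rewrite /Pi adjM trmxCK.
have AE : A = W *m S *m R.
  rewrite /W -!mulmxA (mulmxA S S) (mulmxA R) -AA.
  by rewrite mulmxA -AG.
(* [W *m W^t*] reduces to [A *m G], the projection onto the range of [A], and this fixes [G] and
   hence [W]. *)
have WWW : W *m W^t* *m W = W.
  have -> : W *m W^t* = G *m (A *m A) *m G by rewrite AA hW /W !mulmxA.
  by rewrite mulmxA -AG AGA AG /W !mulmxA GAG.
have PiPi : Pi *m Pi = Pi by rewrite /Pi -mulmxA (mulmxA W) WWW.
pose Qi := 1%:M - Pi.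
have hQi : Qi^t* = Qi by rewrite /Qi raddfB /= trmx1 map_mxB map_mx1 hPi.
have QiQi : Qi *m Qi = Qi.
  by rewrite {2}/Qi mulmxBr mulmx1 mulmxBl mul1mx PiPi subrr subr0.
(* Grouping [A] as [(W *m S) *m R] separates the two states; the factor from [R] is already in final
   form, so only the one from [W *m S] needs work. *)
have h1 := norm_e2_mul_le (W *m S) R; rewrite -AE hR in h1.
apply: le_trans h1 _; apply: ler_wpM2r; first by rewrite -{2}hR e2_gram_ge0.
have -> : (W *m S) *m (W *m S)^t* = W *m S *m (S *m W^t*).
  by rewrite (adjM W) hS.
rewrite e2_mulC.
have -> : S *m W^t* *m (W *m S) = S *m Pi *m (S *m Pi)^t*.
  by rewrite (adjM S Pi) hPi hS [RHS]mulmxA -(mulmxA S Pi Pi) PiPi /Pi !mulmxA.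
(* Cycling has turned the first factor into [e2] of [S *m Pi *m S]. Adding the complementary Gram
   matrix [S *m Qi *m S] restores [S *m S], and [e2] can only grow. *)
have -> : S *m S = S *m Pi *m (S *m Pi)^t* +
    S *m Qi *m (S *m Qi)^t*.
  rewrite (adjM S Pi) (adjM S Qi) hS hPi hQi !(mulmxA _ _ S).
  rewrite -(mulmxA S Pi Pi) -(mulmxA S Qi Qi) PiPi QiQi.
  by rewrite -mulmxDl -mulmxDr addrC subrK mulmx1.
exact: e2_gram_le_add.
Qed.

End Minors.

(** * Positive semidefinite matrices, square roots and density matrices *)

Section Density.
Set Implicit Arguments. Unset Strict Implicit.
Context {R : realType}.
Local Notation C := R[i].

Lemma adjmxE m n (A : 'M[C]_(m, n)) : adjmx A = A^t*.
Proof. by apply/matrixP => i j; rewrite !mxE. Qed.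

Lemma psd_gram n m (Y : 'M[C]_(m, n)) : psd (Y^t* *m Y).
Proof.
rewrite /psd adjmxE adjM trmxCK; split=> // v.
rewrite adjmxE !mulmxA -adjM -mulmxA mxE; apply: sumr_ge0 => k _.
by rewrite !mxE mulrC -normCK exprn_ge0.
Qed.

Lemma psd_conj n m (A : 'M[C]_n) (Y : 'M[C]_(n, m)) :
  psd A -> psd (Y^t* *m A *m Y).
Proof.
rewrite /psd !adjmxE => -[hA A0]; rewrite !adjM trmxCK hA mulmxA.
split=> // v.
by have := A0 (Y *m v); rewrite !adjmxE adjM !mulmxA.
Qed.

Lemma psd_diag_ge0 n (A : 'M[C]_n) i : psd A -> 0 <= A i i.
Proof.
case=> _ /(_ (delta_mx i 0)).
rewrite adjmxE trmx_delta map_delta_mx -mulmxA -colE -rowE !mxE.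
by [].
Qed.

Lemma mxtrace_psd_ge0 n (A : 'M[C]_n) : psd A -> 0 <= \tr A.
Proof. by move=> pA; apply: sumr_ge0 => i _; exact: psd_diag_ge0. Qed.

Lemma psd_sqrt n (A : 'M[C]_n) : psd A -> exists X, psd X /\ X *m X = A.
Proof.
move=> pA; have [hA _] := pA; rewrite adjmxE in hA.
have [U [l [UU AE _]]] := hermitian_unitary_diag hA.
(* The eigenvalues are the diagonal entries of [U *m A *m U^t*], a congruence of [A]. *)
have l0 i : 0 <= l 0 i.
  have := psd_diag_ge0 i (psd_conj (U^t*) pA); rewrite trmxCK AE.
  rewrite /unitary_diag !mulmxA UU mul1mx -mulmxA UU mulmx1 !mxE eqxx mulr1n.
  by [].
exists (unitary_diag U (\row_i sqrtC (l 0 i))); split; last first.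
  rewrite AE (mul_unitary_diag _ _ UU); congr (unitary_diag U _).
  apply/rowP => i.
  by rewrite !mxE -expr2 sqrtCK.
rewrite unitary_diag_gram; first exact: psd_gram.
by move=> i; rewrite mxE sqrtC_ge0.
Qed.

(** [xget] falls back on its default 0 only when no root exists, which [psd_sqrt] excludes. *)
Lemma msqrtP n (A : 'M[C]_n) :
  psd A -> psd (msqrt A) /\ msqrt A *m msqrt A = A.
Proof. by move=> /psd_sqrt h; exact: xgetPex h. Qed.

Lemma superfidelity n (rho sigma : 'M[C]_n) : density rho -> density sigma ->
  0 <= fidelity rho sigma /\
  complex.Re (fidelity rho sigma) <= complex.Re (\tr (rho *m sigma)) +
    Num.sqrt (1 - complex.Re (\tr (rho *m rho))) *
    Num.sqrt (1 - complex.Re (\tr (sigma *m sigma))).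
Proof.
move=> [prho trho] [psigma tsigma].
have [pR RR] := msqrtP prho; have [pS SS] := msqrtP psigma.
have [hR _] := pR; have [hS _] := pS; rewrite !adjmxE in hR hS.
rewrite /fidelity; move: (msqrt rho) (msqrt sigma) pR RR pS SS hR hS.
move=> X Y pX XX pY YY hX hY.
have /msqrtP : psd (X *m sigma *m X) by rewrite -{1}hX; exact: psd_conj.
move: (msqrt _) => A [pA AA]; have [hA _] := pA; rewrite adjmxE in hA.
split; first by rewrite exprn_ge0 ?mxtrace_psd_ge0.
have := superfidelity_e2 hX hY hA; rewrite YY XX => /(_ AA).
(* At trace one, [e2] is one minus the purity; being nonnegative in the complex order, it is
   real. *)
have e2E (B : 'M[C]_n) : \tr B = 1 -> 0 <= e2 B ->
    e2 B = (1 - complex.Re (\tr (B *m B)))%:C%C /\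
    0 <= 1 - complex.Re (\tr (B *m B)).
  rewrite /e2 => ->; rewrite expr1n; case: (\tr _) => a b.
  rewrite lecE /= => /andP[/eqP b0 a0]; split=> //; apply/eqP.
  by rewrite eq_complex /= b0 !eqxx.
have [|rE r0] := e2E _ trho; first by rewrite -XX -{2}hX e2_gram_ge0.
have [|sE s0] := e2E _ tsigma; first by rewrite -YY -{2}hY e2_gram_ge0.
rewrite rE sE mulrC -rmorphM normc_def -rmorphXn lecR.
set N := Num.sqrt (_ + _) => hN.
have ReN : complex.Re (e2 A) <= N.
  by rewrite -lecR -normc_def; apply: le_trans (normc_ge_Re _); rewrite lecR ler_norm.
(* The fidelity is the squared trace of [A], and [\tr (A *m A)] is [\tr (rho *m sigma)] by
   cyclicity. *)
have -> : complex.Re (\tr A ^+ 2) = complex.Re (e2 A) + complex.Re (\tr (rho *m sigma)).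
  by rewrite -raddfD /= /e2 AA mxtrace_mulC mulmxA XX subrK.
rewrite addrC lerD2l; apply: le_trans ReN _.
by rewrite -sqrtrM // -[N]ger0_norm ?sqrtr_ge0 // -sqrtr_sqr ler_wsqrtr.
Qed.

Lemma Re_mxtrace_mul n (A B : 'M[C]_n) :
  complex.Re (\tr (A *m B)) = \sum_(p : 'I_n * 'I_n)
   (complex.Re (A p.1 p.2) * complex.Re (B p.2 p.1)
    - complex.Im (A p.1 p.2) * complex.Im (B p.2 p.1)).
Proof.
rewrite mxtrace_mulE raddf_sum; apply: eq_bigr => p _ /=.
by case: (A _ _) (B _ _) => a b [c e].
Qed.

(** The upper bound is [0 <= e2 A] at trace one. Since the purity is the sum of the squared moduli
    of the entries, it also bounds each entry, which later gives integrability. *)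
Lemma density_purity n (A : 'M[C]_n) : density A ->
  0 <= complex.Re (\tr (A *m A)) <= 1 /\ forall i j, `|A i j| <= 1.
Proof.
case=> pA trA; have [hA _] := pA; rewrite adjmxE in hA.
have [pX XX] := msqrtP pA; have [hX _] := pX; rewrite adjmxE in hX.
have le1 : \tr (A *m A) <= 1.
  by have := e2_gram_ge0 (msqrt A); rewrite hX XX /e2 trA expr1n subr_ge0.
have trE := mxtrace_sqr_hermitian hA; split.
  have ge0 : 0 <= \tr (A *m A).
    by rewrite trE; apply: sumr_ge0 => p _; rewrite exprn_ge0.
  by move: le1 ge0; rewrite !lecE /= => /andP[_ ->] /andP[_ ->].
move=> i j; rewrite -(expr_le1 (ltn0Sn 1)) ?normr_ge0 //.
apply: le_trans le1; rewrite trE (bigD1 (i, j)) //= lerDl.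
by apply: sumr_ge0 => p _; rewrite exprn_ge0.
Qed.

End Density.

(** * Expectations of real functions and of a random state *)

Section Expectation.
Set Implicit Arguments. Unset Strict Implicit.
Context {R : realType} {dT : measure_display} {T : measurableType dT}.
Variable P : probability T R.

(* [f] need not be measurable: the integral of a nonnegative function is a
   supremum over the simple functions below it. *)
Lemma Ereal_le_ge0 (f g : T -> R) : (forall t, 0 <= f t) ->
  (forall t, f t <= g t) -> P.-integrable setT (EFin \o g) ->
  Ereal P f <= Ereal P g.
Proof.
move=> f0 fg ig; have gfin := integrable_fin_num measurableT ig.
have le_int : (\int[P]_x (f x)%:E <= \int[P]_x (g x)%:E)%E.
  rewrite !ge0_integralTE => [|t|t]; rewrite ?lee_fin ?(le_trans (f0 t)) //.
  apply: ereal_sup_le => _ [h hf <-].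
  by exists h => // t; apply: le_trans (hf t) _; rewrite lee_fin.
have f0int : (0 <= \int[P]_x (f x)%:E)%E.
  by apply: integral_ge0 => t _; rewrite lee_fin.
apply: fine_le => //.
by rewrite ge0_fin_numE // (le_lt_trans le_int) // ltey_eq gfin.
Qed.

Lemma bounded_integrable (f : T -> R) M : measurable_fun setT f ->
  (forall t, `|f t| <= M) -> P.-integrable setT (EFin \o f).
Proof.
move=> mf fM; apply: measurable_bounded_integrable => //.
  exact: le_lt_trans (probability_le1 P measurableT) (ltry 1).
exists M; split; first exact: num_real.
by move=> x Mx t _; apply: le_trans (fM t) (ltW Mx).
Qed.

Lemma Ereal_sum (I : finType) (f : I -> T -> R) :
  (forall i, P.-integrable setT (EFin \o f i)) ->
  Ereal P (fun t => \sum_i f i t) = \sum_i Ereal P (f i).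
Proof.
move=> fi; rewrite /Ereal /Rintegral.
under eq_integral => t _ do rewrite -sumEFin.
rewrite integral_sum // -sum_fine // => i _.
exact: integrable_fin_num (fi i).
Qed.

Variables (d : nat) (rho : T -> 'M[R[i]]_d).
Hypothesis rho_meas : forall i j,
  measurable_fun setT (fun t => complex.Re (rho t i j)) /\
  measurable_fun setT (fun t => complex.Im (rho t i j)).
Hypothesis rho_state : forall t, density (rho t).

Lemma integrable_rho i j :
  P.-integrable setT (EFin \o (fun t => complex.Re (rho t i j))) /\
  P.-integrable setT (EFin \o (fun t => complex.Im (rho t i j))).
Proof.
have [mRe mIm] := rho_meas i j.
have le1 t : `|complex.Re (rho t i j)| <= 1 /\ `|complex.Im (rho t i j)| <= 1.
  have [_ /(_ i j)] := density_purity (rho_state t).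
  rewrite normc_def -[1 : R[i]]/(1%:C)%C lecR => le1.
  by split; rewrite -sqrtr_sqr (le_trans _ le1) // ler_wsqrtr //
    ?lerDl ?lerDr sqr_ge0.
by split; apply: (@bounded_integrable _ 1) => // t; have [] := le1 t.
Qed.

(** The function is a real linear combination of real and imaginary parts of entries of the state,
    so the expectation passes inside. It serves with [K] equal to [sigma] and to the identity. *)
Lemma Ereal_Re_mxtrace_mul (K : 'M[R[i]]_d) :
  P.-integrable setT (EFin \o (fun t => complex.Re (\tr (rho t *m K)))) /\
  Ereal P (fun t => complex.Re (\tr (rho t *m K))) =
  complex.Re (\tr (Emx P rho *m K)).
Proof.
have fE : (fun t => complex.Re (\tr (rho t *m K))) =
    (fun t => \sum_(p : 'I_d * 'I_d)
   (complex.Re (rho t p.1 p.2) * complex.Re (K p.2 p.1)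
    - complex.Im (rho t p.1 p.2) * complex.Im (K p.2 p.1))).
  by apply/funext => t; rewrite Re_mxtrace_mul.
have iRe i j k : P.-integrable setT (EFin \o (fun t => complex.Re (rho t i j) * k)).
  have [h _] := integrable_rho i j.
  by have := integrableZr measurableT k h; apply: eq_integrable.
have iIm i j k : P.-integrable setT (EFin \o (fun t => complex.Im (rho t i j) * k)).
  have [_ h] := integrable_rho i j.
  by have := integrableZr measurableT k h; apply: eq_integrable.
have iD (p : 'I_d * 'I_d) : P.-integrable setT (EFin \o (fun t =>
   (complex.Re (rho t p.1 p.2) * complex.Re (K p.2 p.1)
    - complex.Im (rho t p.1 p.2) * complex.Im (K p.2 p.1)))).
  have := integrableB measurableT (iRe p.1 p.2 (complex.Re (K p.2 p.1)))
    (iIm p.1 p.2 (complex.Im (K p.2 p.1))).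
  by apply: eq_integrable.
rewrite fE; split.
  have := integrable_sum measurableT (index_enum _) (P := xpredT) (fun p _ => iD p).
  by apply: eq_integrable => // t _ /=; rewrite sumEFin.
rewrite Ereal_sum // Re_mxtrace_mul; apply: eq_bigr => p _.
have [hRe hIm] := integrable_rho p.1 p.2.
by rewrite /Ereal RintegralB // !RintegralZr // !mxE.
Qed.

Lemma measurable_sqrt_purity :
  measurable_fun setT
    (fun t => Num.sqrt (1 - complex.Re (\tr (rho t *m rho t)))).
Proof.
apply: (measurableT_comp (continuous_measurable_fun (@sqrt_continuous R))).
apply: measurable_funB => //.
under eq_fun do rewrite Re_mxtrace_mul.
apply: measurable_sum => p; have [mRe mIm] := rho_meas p.1 p.2.
have [mRe' mIm'] := rho_meas p.2 p.1.
by apply: measurable_funB; apply: measurable_funM.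
Qed.

End Expectation.

(** * Two Cauchy-Schwarz inequalities for the elimination of [sigma], and the mean state *)

Section Mean.
Set Implicit Arguments. Unset Strict Implicit.
Context {R : realType}.

(* Cauchy-Schwarz for the components orthogonal to the identity matrix. *)
Lemma Re_mxtrace_mul_le d (A B : 'M[R[i]]_d) : (0 < d)%N ->
  A^t* = A -> B^t* = B -> \tr A = 1 -> \tr B = 1 ->
  [/\ 0 <= complex.Re (\tr (A *m A)) - d%:R^-1,
      0 <= complex.Re (\tr (B *m B)) - d%:R^-1 &
      complex.Re (\tr (A *m B)) - d%:R^-1 <=
      Num.sqrt (complex.Re (\tr (A *m A)) - d%:R^-1) *
      Num.sqrt (complex.Re (\tr (B *m B)) - d%:R^-1)].
Proof.
move=> d0 hA hB tA tB; set c : R := d%:R^-1.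
have cd : c * d%:R = 1 by rewrite mulVf // pnatr_eq0 -lt0n.
(* The maximally mixed state: the orthogonal projection of every trace-one matrix onto the span of
   the identity. *)
pose K : 'M[R[i]]_d := (c%:C%C)%:M.
have hK : K^t* = K.
  by rewrite /K tr_scalar_mx map_scalar_mx; congr (_%:M); exact: conjc_real.
have hsub (X : 'M[R[i]]_d) : X^t* = X -> (X - K)^t* = X - K.
  by move=> hX; rewrite raddfB /= map_mxB hX hK.
have trE (X Y : 'M[R[i]]_d) : \tr X = 1 -> \tr Y = 1 ->
    \tr ((X - K) *m (Y - K)) = \tr (X *m Y) - c%:C%C.
  move=> tX tY; rewrite mulmxBl !mulmxBr !raddfB /=.
  rewrite /K mul_mx_scalar !mul_scalar_mx !mxtraceZ tX tY mxtrace_scalar.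
  have -> : c%:C%C *+ d = 1 :> R[i] by rewrite -rmorphMn /= -mulr_natr cd.
  by rewrite mulr1 opprK addNr addr0.
have sqr_re (X : 'M[R[i]]_d) : X^t* = X -> \tr X = 1 ->
    \tr ((X - K) *m (X - K)) = (complex.Re (\tr (X *m X)) - c)%:C%C /\
    0 <= complex.Re (\tr (X *m X)) - c.
  move=> hX tX; have : 0 <= \tr ((X - K) *m (X - K)).
    rewrite mxtrace_sqr_hermitian; last exact: hsub.
    by apply: sumr_ge0 => p _; rewrite exprn_ge0.
  rewrite trE //; case: (\tr _) => a b; rewrite lecE /= => /andP[/eqP b0 ac].
  by split=> //; apply/eqP; rewrite eq_complex /= b0 !eqxx.
have [AE A0] := sqr_re A hA tA; have [BE B0] := sqr_re B hB tB.
split=> //; have := norm_mxtrace_mul_le (hsub A hA) (hsub B hB).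
rewrite AE BE trE // -rmorphM normc_def -rmorphXn lecR.
set z := \tr (A *m B) - _; set N := Num.sqrt (_ + _) => hN.
have -> : complex.Re (\tr (A *m B)) - c = complex.Re z by rewrite raddfB.
apply: (@le_trans _ _ N); last first.
  by rewrite -sqrtrM // -[N]ger0_norm ?sqrtr_ge0 // -sqrtr_sqr ler_wsqrtr.
apply: le_trans (ler_norm _) _.
by rewrite -sqrtr_sqr ler_wsqrtr // lerDl sqr_ge0.
Qed.

(** Cauchy-Schwarz in the plane for the vectors (sqrt x, a) and (sqrt y, w). *)
Lemma cauchy_schwarz_sqrt (x y a w : R) : 0 <= x -> 0 <= y ->
  0 <= a -> 0 <= w ->
  Num.sqrt x * Num.sqrt y + a * w <=
  Num.sqrt ((y + w ^+ 2) * (x + a ^+ 2)).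
Proof.
move=> x0 y0 a0 w0.
have [xs ys] := (sqr_sqrtr x0, sqr_sqrtr y0).
set u := Num.sqrt x in xs *; set v := Num.sqrt y in ys *.
have [u0 v0] : 0 <= u /\ 0 <= v by rewrite !sqrtr_ge0.
rewrite -[leLHS]ger0_norm ?addr_ge0 ?mulr_ge0 // -sqrtr_sqr ler_wsqrtr //.
rewrite -xs -ys -subr_ge0.
have -> : (v ^+ 2 + w ^+ 2) * (u ^+ 2 + a ^+ 2) - (u * v + a * w) ^+ 2 =
  (v * a - u * w) ^+ 2 by ring.
exact: sqr_ge0.
Qed.

Context {dT : measure_display} {T : measurableType dT}.
Variables (P : probability T R) (d : nat) (rho : T -> 'M[R[i]]_d).
Hypothesis rho_meas : forall i j,
  measurable_fun setT (fun t => complex.Re (rho t i j)) /\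
  measurable_fun setT (fun t => complex.Im (rho t i j)).
Hypothesis rho_state : forall t, density (rho t).

Lemma Emx_hermitian : (Emx P rho)^t* = Emx P rho.
Proof.
have hrho t i j : rho t i j = (rho t j i)^*%C.
  by have [[/matrixP/(_ i j) <- _] _] := rho_state t; rewrite mxE.
apply/matrixP => i j; rewrite !mxE; apply/eqP; rewrite eq_complex /=.
apply/andP; split; apply/eqP.
  congr (Ereal P _); apply/funext => t.
  by rewrite (hrho t j i); case: (rho t i j).
have [_ hI] := integrable_rho P rho_meas rho_state j i.
rewrite -mulN1r /Ereal -RintegralZl //.
congr (Ereal P _); apply/funext => t.
by rewrite (hrho t i j) mulN1r; case: (rho t j i).
Qed.

Lemma mxtrace_Emx : \tr (Emx P rho) = 1.
Proof.
have [_] := Ereal_Re_mxtrace_mul P rho_meas rho_state 1%:M.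
under eq_fun => t do rewrite mulmx1 (rho_state t).2 /=.
rewrite mulmx1 /Ereal Rintegral_cst // [X in fine X](probability_setT P) mul1r => re1.
(* The real part is settled by linearity; hermiticity of the mean makes the imaginary part
   vanish. *)
have : (\tr (Emx P rho))^*%C = \tr (Emx P rho).
  rewrite -[in RHS]Emx_hermitian /mxtrace rmorph_sum.
  by apply: eq_bigr => i _; rewrite !mxE.
move: re1; case: (\tr _) => a b /= <- [] /eqP.
by rewrite eq_sym -subr_eq0 opprK -mulr2n mulrn_eq0 /= => /eqP ->.
Qed.

End Mean.

(** * Averaging the pointwise bound and eliminating [sigma] *)

Theorem theorem3 (R : realType) (d : nat) (hd : (0 < d)%N)
  (dT : measure_display) (T : measurableType dT) (P : probability T R)
  (rho : T -> 'M[R[i]]_d)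
  (rho_meas : forall i j, measurable_fun setT (fun t => complex.Re (rho t i j)) /\
                          measurable_fun setT (fun t => complex.Im (rho t i j)))
  (rho_state : forall t, density (rho t))
  (sigma : 'M[R[i]]_d) (sigma_state : density sigma) :
  Ereal P (fun t => complex.Re (fidelity (rho t) sigma)) <=
  d%:R^-1 * (1 + Num.sqrt (d%:R - 1) *
    Num.sqrt (d%:R * (Ereal P (fun t => Num.sqrt (1 - complex.Re (\tr (rho t *m rho t)))) ^+ 2
                      + complex.Re (\tr (Emx P rho *m Emx P rho))) - 1)).
Proof.
have [/andP[s0 s1] _] := density_purity sigma_state.
set s := complex.Re (\tr (sigma *m sigma)) in s0 s1.
pose g t := Num.sqrt (1 - complex.Re (\tr (rho t *m rho t))).
pose w := Num.sqrt (1 - s); pose c : R := d%:R^-1.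
have w0 : 0 <= w by exact: sqrtr_ge0.
have w2 : w ^+ 2 = 1 - s by rewrite sqr_sqrtr // subr_ge0.
have g0 t : 0 <= g t by exact: sqrtr_ge0.
have ig : P.-integrable setT (EFin \o g).
  apply: (@bounded_integrable _ _ _ _ _ 1).
    exact: measurable_sqrt_purity.
  move=> t; rewrite ger0_norm // -sqrtr1 ler_wsqrtr // gerBl.
  by have [/andP[]] := density_purity (rho_state t).
have igw : P.-integrable setT (EFin \o (fun t => g t * w)).
  by have := integrableZr measurableT w ig; apply: eq_integrable.
have [it Et] := Ereal_Re_mxtrace_mul P rho_meas rho_state sigma.
have iD : P.-integrable setT
    (EFin \o (fun t => complex.Re (\tr (rho t *m sigma)) + g t * w)).
  by have := integrableD measurableT it igw; apply: eq_integrable.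
have leF : Ereal P (fun t => complex.Re (fidelity (rho t) sigma)) <=
    complex.Re (\tr (Emx P rho *m sigma)) + Ereal P g * w.
  rewrite -Et; apply: (le_trans (Ereal_le_ge0 _ _ iD)) => [t|t|].
  - have [] := superfidelity (rho_state t) sigma_state.
    by rewrite lecE /= => /andP[].
  - by have [] := superfidelity (rho_state t) sigma_state.
  by rewrite /Ereal RintegralD // RintegralZr.
apply: (le_trans leF); rewrite -/g; set a := Ereal P g.
have a0 : 0 <= a by apply: Rintegral_ge0.
have hsigma : sigma^t* = sigma by have [[h _] _] := sigma_state; rewrite adjmxE in h.
have hmu := Emx_hermitian P rho_meas rho_state.
have tmu := mxtrace_Emx P rho_meas rho_state.
have [] := Re_mxtrace_mul_le hd hmu hsigma tmu sigma_state.2.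
set q := complex.Re (\tr (Emx P rho *m Emx P rho)); rewrite -/s -/c.
set t := complex.Re _ => q0 s'0 tle.
have D1 : 1 <= d%:R :> R by rewrite ler1n.
have D0 : 0 < d%:R :> R by rewrite ltr0n.
have cD : c * d%:R = 1 by rewrite mulVf // gt_eqF.
(* Here [sigma] drops out: [s - c + w ^+ 2] is [1 - c] whatever the purity [s]. The outer factor
   [d%:R] enters the root as a square, one copy going to each factor. *)
have -> : Num.sqrt (d%:R - 1) * Num.sqrt (d%:R * (a ^+ 2 + q) - 1) =
    d%:R * Num.sqrt ((s - c + w ^+ 2) * (q - c + a ^+ 2)).
  rewrite -sqrtrM ?subr_ge0 // -{3}(ger0_norm (ltW D0)) -sqrtr_sqr -sqrtrM ?sqr_ge0 //.
  congr Num.sqrt; rewrite w2; transitivity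
    ((d%:R - c * d%:R) * (d%:R * (a ^+ 2 + q) - c * d%:R)); last by ring.
  by rewrite cD.
(* Moving [c] to the left leaves [t - c], the overlap of the components orthogonal to the identity,
   which [tle] bounds. *)
rewrite mulrDr mulr1 mulrA -/c cD mul1r -lerBlDl.
apply: le_trans (cauchy_schwarz_sqrt q0 s'0 a0 w0).
by rewrite addrAC lerD2r.
Qed.
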